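(* Let $z>0$, let $\phi=\phi(x;z)=x^2-z^2$, and let $P_n=P_n(x;z)$ be the monic truncated Hermite polynomials with recurrence coefficients $\gamma_n=\gamma_n(z)$ (with $\gamma_0=0$). For $n\ge 0$ let $C_{n}=C_n(x;z)=\phi(x;z)+\gamma_{n}(z)+\gamma_{n+1}(z)-n-\frac{1}{2}$, and for $n\ge1$ define the differential operator $$D_{n}=\phi^{2}C_{n}\,\partial_{x}^{2}-2x\phi\left[(\phi-1)C_{n}+\phi\right]\partial_{x}+(n-2\gamma_{n})\left[2x^{2}\phi-\left(\phi-2x^{2}\phi+nx^{2}-2x^{2}\gamma_{n}\right)C_{n}\right]+4\gamma_{n}C_{n-1}C_{n}^{2}.$$ Then $D_{n}P_{n}=0$ for all $n\in\mathbb{N}$ (that is, $n\ge 1$).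
   Context: For $z>0$ let $L[p]=\int_{-z}^{z}p(x)e^{-x^{2}}dx$, $p\in\mathbb{R}[x]$. The truncated Hermite polynomials $P_n(x;z)$, $n\ge0$, are the monic polynomials in $x$ with $\deg P_n=n$ and $L[P_kP_n]=h_n(z)\delta_{k,n}$, where $h_n(z)=L[P_n^2]>0$. They satisfy the three-term recurrence $xP_n(x;z)=P_{n+1}(x;z)+\gamma_n(z)P_{n-1}(x;z)$ with $P_{-1}=0$, $P_0=1$, where $\gamma_n(z)=h_n(z)/h_{n-1}(z)$ for $n\ge1$; convention: $\gamma_0=0$. *)

(* Defs.v *)
From HB Require Import structures.
From mathcomp Require Import all_boot all_order all_algebra.
From mathcomp Require Import all_classical all_reals all_analysis.

Set Implicit Arguments.
Unset Strict Implicit.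
Unset Printing Implicit Defensive.

Import Order.TTheory GRing.Theory Num.Theory.
Import numFieldNormedType.Exports.

Local Open Scope classical_set_scope.
Local Open Scope ring_scope.

Section TruncatedHermite.
Context {R : realType}.
Implicit Types (z : R) (p : {poly R}) (P : nat -> {poly R}) (n : nat).

Definition hermite_functional z p : R :=
  \int[@lebesgue_measure R]_(x in `[- z, z]) (p.[x] * expR (- x ^+ 2)).

Definition hermite_norm z P n : R := hermite_functional z (P n ^+ 2).

(* Characterizes the family uniquely when 0 < z; the positivity of
   hermite_norm z P n is then a consequence and is not assumed. *)
Definition truncated_hermite z P : Prop :=
  [/\ forall n, P n \is monic,
      forall n, size (P n) = n.+1
    & forall k n, hermite_functional z (P k * P n)
                  = hermite_norm z P n * (k == n)%:R].

(* For truncated_hermite z P and 0 < z these are the coefficients of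
   'X * P n = P n.+1 + gamma_n * P n.-1; the value at 0 is a convention. *)
Definition hermite_gamma z P n : R :=
  if n is m.+1 then hermite_norm z P m.+1 / hermite_norm z P m else 0.

Definition hermite_phi z : {poly R} := 'X^2 - (z ^+ 2)%:P.

Definition hermite_C z P n : {poly R} :=
  hermite_phi z
  + (hermite_gamma z P n + hermite_gamma z P n.+1 - n%:R - 2^-1)%:P.

(* The differential operator acts on {poly R} through formal differentiation.
   Only n >= 1 is meaningful, because of hermite_C z P n.-1. *)
Definition hermite_D z P n p : {poly R} :=
  let phi := hermite_phi z in
  let C := hermite_C z P in
  let gamma := hermite_gamma z P n in
  phi ^+ 2 * C n * p^`(2)
  - 2 * 'X * phi * ((phi - 1) * C n + phi) * p^`()
  + ((n%:R - 2 * gamma)%:P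
       * (2 * 'X^2 * phi
          - (phi - 2 * 'X^2 * phi + n%:R * 'X^2 - 2 * 'X^2 * gamma%:P) * C n)
     + 4 * gamma%:P * C n.-1 * C n ^+ 2) * p.

End TruncatedHermite.

(* Main.v *)
(** Integrating by parts against exp(-x^2), the boundary terms vanish on
    multiples of phi = x^2 - z^2, so L[(phi p)'] = L[2 x phi p]. Together with
    orthogonality and the parity of the weight this yields the lowering relation
      phi P_n' = (n - 2 gamma_n) x P_n + 2 gamma_n C_n P_(n-1):
    with gamma_n P_(n-1) = x P_n - P_(n+1), the cubic terms of
    L[(lhs - rhs) q] cancel, and only the coefficient of x^(n-1) in q survives
    when deg q < n. Rewriting the same relation at n - 1 through the
    three-term recurrence gives the raising relation
      phi P_(n-1)' = (2 phi - n + 2 gamma_n) x P_(n-1) - 2 C_(n-1) P_n,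
    and eliminating P_(n-1) between the two produces D_n P_n = 0. *)
Require Import Defs.
From HB Require Import structures.
From mathcomp Require Import all_boot all_order all_algebra.
From mathcomp Require Import all_classical all_reals all_analysis.
From mathcomp Require Import ring lra zify.

Set Implicit Arguments.
Unset Strict Implicit.
Unset Printing Implicit Defensive.

Import Order.TTheory GRing.Theory Num.Theory.
Import numFieldNormedType.Exports.

Local Open Scope classical_set_scope.
Local Open Scope ring_scope.

(** * Truncated Gaussian functional: integration by parts, definiteness, reflection *)

Section HermiteFunctional.
Context {R : realType}.
Implicit Types (z x : R) (p q : {poly R}).

Local Notation L := hermite_functional.
Local Notation mu := (@lebesgue_measure R).
Local Notation weighted p := (fun x : R => p.[x] * expR (- x ^+ 2)).

Lemma is_derive_weighted p x :
  is_derive x 1 (weighted p) ((p^`() - 2 * 'X * p).[x] * expR (- x ^+ 2)).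
Proof.
have -> : weighted p = horner p * (expR \o horner (- 'X^2)).
  by apply/funext => y; rewrite fctE /= !hornerE.
apply: is_derive_eq.
rewrite derivN derivXn /= !hornerE /GRing.scale /=; ring.
Qed.

Lemma continuous_weighted p : continuous (weighted p).
Proof.
move=> x; apply/differentiable_continuous/derivable1_diffP.
by have [] := is_derive_weighted p x.
Qed.

Lemma weighted_integrable z p : mu.-integrable `[- z, z] (EFin \o weighted p).
Proof.
apply: continuous_compact_integrable; first exact: segment_compact.
exact/continuous_subspaceT/continuous_weighted.
Qed.

Lemma hermite_functionalD z p q : L z (p + q) = L z p + L z q.
Proof.
rewrite /hermite_functional -RintegralD//; try exact: weighted_integrable.
by apply: eq_Rintegral => x _; rewrite hornerD mulrDl.
Qed.

Lemma hermite_functionalZ z a p : L z (a *: p) = a * L z p.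
Proof.
rewrite /hermite_functional -RintegralZl//; last exact: weighted_integrable.
by apply: eq_Rintegral => x _; rewrite hornerZ mulrA.
Qed.

Lemma hermite_functional_deriv z p : 0 < z ->
  L z (p^`() - 2 * 'X * p) = (p.[z] - p.[- z]) * expR (- z ^+ 2).
Proof.
move=> z0; rewrite /hermite_functional /Rintegral.
rewrite (@continuous_FTC2 _ _ (weighted p)) /=.
- by rewrite sqrrN; ring.
- lra.
- exact/continuous_subspaceT/continuous_weighted.
- split.
  + by move=> x _; have [] := is_derive_weighted p x.
  + exact/cvg_at_right_filter/continuous_weighted.
  + exact/cvg_at_left_filter/continuous_weighted.
- move=> x _; rewrite derive1E.
  by have dp := is_derive_weighted p x; rewrite derive_val.
Qed.

(** A nonnegative integrand with zero integral vanishes almost everywhere. For nonzero [p], a null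
    set and finitely many roots would then cover the interval, whose length is positive. *)
Lemma hermite_functional_sqr_eq0 z p : 0 < z -> L z (p ^+ 2) = 0 -> p = 0.
Proof.
move=> z0 Lp; apply/eqP/negPn/negP => p0.
have int_p := weighted_integrable z (p ^+ 2).
have mD : measurable (`[- z, z] : set R) by [].
have: (\int[mu]_(x in `[(- z)%R, z]) `|(EFin \o weighted (p ^+ 2)) x|)%E = 0%E.
  rewrite -[RHS](_ : (fine (\int[mu]_(x in `[(- z)%R, z])
     ((EFin \o weighted (p ^+ 2)) x)))%:E = 0%E); last by congr EFin.
  rewrite fineK; last exact: integrable_fin_num.
  apply: eq_integral => x _ /=; rewrite ger0_norm//.
  by rewrite mulr_ge0 ?expR_ge0// horner_exp sqr_ge0.
have mf := measurable_int mu int_p.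
move/(ae_eq_integral_abs mu mD mf) => [N [mN N0 sub]].
have fin_roots : finite_set [set x | root p x].
  apply: contrapT => /infinite_set_fset -/(_ (size p))[B Bp].
  rewrite leqNgt => /negP; apply; apply: max_poly_roots => //;
    last exact: finmap.fset_uniq.
  by apply/allP => x xB; exact: Bp.
have : mu.-negligible (`[- z, z] : set R).
  apply: (@negligibleS _ _ _ mu (N `|` [set x | root p x])).
    move=> x zx; have [px|px] := boolP (root p x); [by right|left].
    apply: sub => /= /(_ zx) [] /eqP.
    rewrite horner_exp mulf_eq0 [expR _ == 0]gt_eqF ?expR_gt0// orbF.
    by rewrite expf_eq0/= -rootE (negbTE px).
  apply: negligibleU; first by exists N; split=> //.
  have mroots := countable_lebesgue_measure0 (finite_set_countable fin_roots).
  exists [set x | root p x]; split=> //.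
  exact/countable_measurable/finite_set_countable.
move/(iffLR (negligibleP mu mD)) => mu0.
have : mu (`[- z, z] : set R) = 0%E := mu0.
rewrite lebesgue_measure_itv/= lte_fin.
have -> : - z < z by lra.
by move=> [] ; lra.
Qed.

Lemma hermite_functional_compN z p : 0 < z -> L z (p \Po (- 'X)) = L z p.
Proof.
move=> z0; rewrite /hermite_functional /Rintegral.
have := @integration_by_substitution_oppr _ (weighted p) (- z) z.
rewrite opprK => ->.
- congr fine; apply: eq_integral => x _ /=.
  by rewrite horner_comp !hornerE sqrrN.
- lra.
- exact/continuous_subspaceT/continuous_weighted.
Qed.

End HermiteFunctional.


(** One step of leading-term elimination; it drives the degree arguments for [P] below. *)
Lemma size_sub_monic (F : nzRingType) n (p q : {poly F}) :
  p \is monic -> size p = n.+1 -> (size q <= n.+1)%N ->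
  (size (q - q`_n *: p)%R <= n)%N.
Proof.
move=> /monicP p1 sp sq; apply/leq_sizeP => j; rewrite coefB coefZ.
rewrite leq_eqVlt => /predU1P[<-|nj].
  by move: p1; rewrite lead_coefE sp /= => ->; rewrite mulr1 subrr.
rewrite [q`_j]nth_default ?(leq_trans sq)// [p`_j]nth_default ?sp//.
by rewrite mulr0 subrr.
Qed.

HB.instance Definition _ (R : realType) (z : R) :=
  GRing.isLinear.Build R {poly R} R *%R (hermite_functional z)
    (fun a p q => etrans (hermite_functionalD z (a *: p) q)
       (congr1 (+%R^~ _) (hermite_functionalZ z a p))).

Local Arguments hermite_gamma : simpl never.
Local Arguments hermite_norm : simpl never.

(** * Orthogonality, parity and the three-term recurrence *)

Section TruncatedHermitePolynomials.
Context (R : realType) (z : R) (z_gt0 : 0 < z).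
Context (P : nat -> {poly R}) (hP : truncated_hermite z P).

Local Notation L := (hermite_functional z).
Local Notation h := (hermite_norm z P).
Local Notation g := (hermite_gamma z P).
Local Notation phi := (hermite_phi z).

Let P_monic n : P n \is monic. Proof. by have [] := hP. Qed.
Let size_P n : size (P n) = n.+1. Proof. by have [] := hP. Qed.
Let P_orth k n : L (P k * P n) = h n * (k == n)%:R.
Proof. by have [] := hP. Qed.

Let coef_P n j : (n <= j)%N -> (P n)`_j = (j == n)%:R.
Proof.
rewrite leq_eqVlt => /predU1P[<-|nj].
  by have /eqP := P_monic n; rewrite lead_coefE size_P eqxx.
by rewrite nth_default ?size_P// gtn_eqF.
Qed.

Lemma hermite_norm_neq0 n : h n != 0.
Proof.
apply/eqP => /(hermite_functional_sqr_eq0 z_gt0) P0.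
by have := size_P n; rewrite P0 size_poly0.
Qed.

(** Modulo terms of degree below n, which are orthogonal to [P n], [q] is its coefficient of x^n
    times [P n]. Later pairings thus reduce to reading off one coefficient. *)
Lemma hermite_functional_coef n (q : {poly R}) :
  (size q <= n.+1)%N -> L (q * P n) = q`_n * h n.
Proof.
have orth m : (m <= n)%N ->
    forall q : {poly R}, (size q <= m)%N -> L (q * P n) = 0.
  elim: m => [_ p|m IH mn p sp].
    by rewrite size_poly_leq0 => /eqP->; rewrite mul0r raddf0.
  rewrite -[p](subrK (p`_m *: P m)) mulrDl raddfD /=.
  rewrite (IH (ltnW mn)) ?size_sub_monic// add0r -scalerAl linearZ /= P_orth.
  by rewrite ltn_eqF// !mulr0.
move=> sq; rewrite -[q in LHS](subrK (q`_n *: P n)) mulrDl raddfD /=.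
rewrite (orth n)// ?size_sub_monic// add0r -scalerAl linearZ /= P_orth.
by rewrite eqxx mulr1.
Qed.

Lemma hermite_functional_orth n (q : {poly R}) :
  (size q <= n)%N -> L (q * P n) = 0.
Proof.
by move=> sq; rewrite hermite_functional_coef 1?leqW// nth_default ?mul0r.
Qed.

(** Pairing with the [P k] of highest index isolates the top coefficient; it vanishes because the
    norm is nonzero, and the size bound drops by one. *)
Lemma hermite_expansion_eq0 n (r : {poly R}) :
  (size r <= n)%N -> (forall k, (k < n)%N -> L (r * P k) = 0) -> r = 0.
Proof.
elim: n => [|n IH] sr rP; first by apply/eqP; rewrite -size_poly_leq0.
apply: IH => [|k kn]; last exact/rP/ltnW.
apply/leq_sizeP => j; rewrite leq_eqVlt => /predU1P[<-|nj]; last first.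
  by rewrite nth_default// (leq_trans sr).
have /eqP := rP n (ltnSn n).
rewrite hermite_functional_coef// mulf_eq0.
by rewrite (negbTE (hermite_norm_neq0 n)) orbF => /eqP.
Qed.

(** The difference [D] of the two sides has degree below n and is orthogonal to itself, so
    definiteness kills it. *)
Lemma hermite_parity n : P n \Po (- 'X) = (-1) ^+ n *: P n.
Proof.
have sN p : size (p \Po (- 'X) : {poly R}) = size p.
  by rewrite size_comp_poly2// size_polyN size_polyX.
pose T := P n \Po (- 'X).
have Tn : T`_n = (-1) ^+ n.
  have : lead_coef T = (-1) ^+ n.
    rewrite lead_coef_comp ?size_polyN ?size_polyX// size_P.
    rewrite (eqP (P_monic n)) mul1r.
    by rewrite lead_coefN lead_coefX.
  by rewrite lead_coefE sN size_P.
apply/eqP; rewrite -subr_eq0; apply/eqP; rewrite -/T -Tn.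
set D := T - _.
have sD : (size D <= n)%N by rewrite size_sub_monic// sN size_P.
(* One factor of the square is expanded. Its [P n] part pairs to zero with [D] by degree; in the
   other part, x -> -x turns [T] into [P n] and leaves the degree of [D] unchanged. *)
apply: (hermite_functional_sqr_eq0 z_gt0); rewrite expr2 {2}/D mulrBr raddfB /=.
rewrite -scalerAr linearZ /= hermite_functional_orth// mulr0 subr0.
rewrite -(hermite_functional_compN _ z_gt0) comp_polyM -comp_polyA.
rewrite [(- 'X) \Po _]raddfN /= comp_polyX opprK comp_polyXr.
by rewrite hermite_functional_orth// sN.
Qed.

Lemma hermite_functional_odd (q : {poly R}) : q \Po (- 'X) = - q -> L q = 0.
Proof.
move=> qN; have := hermite_functional_compN q z_gt0.
rewrite qN raddfN /= => /eqP; rewrite eq_sym -addr_eq0 -mulr2n.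
by rewrite mulrn_eq0 => /eqP.
Qed.

Lemma hermite_gammaS n : g n.+1 * h n = h n.+1.
Proof. by rewrite /= divfK// hermite_norm_neq0. Qed.

Lemma hermite_0 : P 0 = 1.
Proof.
have /size_poly1P[c c0 Pc] : size (P 0%N) == 1%N by rewrite size_P.
by have /eqP := P_monic 0; rewrite Pc lead_coefC => ->.
Qed.

(** The integrand is odd; this is why the recurrence has no diagonal term. *)
Lemma hermite_functional_XP2 n : L ('X * P n * P n) = 0.
Proof.
apply: hermite_functional_odd; rewrite !comp_polyM comp_polyX hermite_parity.
rewrite -scalerAr -scalerAr -scalerAl scalerA -expr2 sqrr_sign scale1r.
by rewrite !mulNr.
Qed.

Lemma hermite_1 : P 1 = 'X.
Proof.
have X0 : P 1 = 'X + ((P 1)`_0)%:P.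
  apply/polyP => -[|i]; rewrite coefD coefC coefX ?add0r//= addr0.
  by rewrite coef_P.
have XP0 : L ('X * P 0) = 0.
  by have := hermite_functional_XP2 0; rewrite {2}hermite_0 mulr1.
have LP0 : L (P 0) = h 0.
  by have := P_orth 0 0; rewrite {1}hermite_0 mul1r mulr1.
have := P_orth 1 0; rewrite X0 mulrDl raddfD /= XP0 mul_polyC linearZ /= LP0.
rewrite add0r mulr0 => /eqP.
rewrite mulf_eq0 (negbTE (hermite_norm_neq0 0)) orbF => /eqP ->.
by rewrite addr0.
Qed.

(** The leading terms on the left cancel, so it suffices to pair the difference of the two sides
    with each [P k], k <= n+1: parity settles k = n+1, and moving 'X onto [P k] settles the rest. *)
Lemma hermite_recurrence n :
  'X * P n.+1 - P n.+2 = g n.+1 *: P n.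
Proof.
apply/eqP; rewrite -subr_eq0; apply/eqP.
have := hermite_gammaS n; move: (g n.+1) => gn gnE.
apply: (@hermite_expansion_eq0 n.+2) => [|k kn].
  apply/leq_sizeP => -[//|j] nj; rewrite !coefB coefZ coefXM/=.
  rewrite !coef_P//; try lia.
  by rewrite eqSS subrr (@gtn_eqF n) ?mulr0 ?subrr//; lia.
rewrite !mulrBl !raddfB /= -scalerAl linearZ /= !P_orth.
rewrite (gtn_eqF kn) mulr0 subr0.
move: kn; rewrite ltnS leq_eqVlt => /predU1P[->|kn].
  by rewrite hermite_functional_XP2 ltn_eqF// !mulr0 subrr.
rewrite mulrAC hermite_functional_coef; last first.
  by rewrite (leq_trans (size_polyMleq _ _))// size_polyX size_P.
rewrite coefXM/= coef_P// -gnE.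
by case: eqVneq => [->|_]; rewrite /= ?(mulr0, mul0r, mulr1, mul1r) subrr.
Qed.

(** * The lowering relation *)

Lemma hermite_functional_phi_deriv (p : {poly R}) :
  L ((phi * p)^`()) = L (2 * 'X * (phi * p)).
Proof.
apply/eqP; rewrite -subr_eq0 -raddfB /= hermite_functional_deriv//.
by rewrite /hermite_phi !hornerM !hornerE sqrrN subrr !mul0r subrr mul0r.
Qed.

Lemma coef_phiM (p : {poly R}) i :
  (phi * p)`_i.+2 = p`_i - z ^+ 2 * p`_i.+2.
Proof. by rewrite /hermite_phi mulrBl coefB mul_polyC coefZ coefXnM subn2. Qed.

Lemma size_phiM (p : {poly R}) n :
  (size p <= n)%N -> (size (phi * p)%R <= n.+2)%N.
Proof.
move=> sp; apply/leq_sizeP => -[//|[//|i]] ni.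
have ni2 : (n <= i.+2)%N by rewrite ltnW// ltnW.
by rewrite coef_phiM !nth_default ?mulr0 ?subrr// (leq_trans sp).
Qed.

(** Writing gamma_n P_(n-1) as ['X * P n - P n.+1] includes n = 0, where both sides vanish; the
    raising relation for [P 1] needs that case. *)
Lemma hermite_structure n :
  phi * (P n)^`() = (n%:R - 2 * g n) *: ('X * P n)
                    + 2 * hermite_C z P n * ('X * P n - P n.+1).
Proof.
case: n => [|m].
  rewrite hermite_0 hermite_1 derivC /= !mulr0 subrr scale0r mulr1 subrr.
  by rewrite !mulr0 addr0.
set n := m.+1; set a := n%:R - _.
have CE : hermite_C z P n = phi + (g n + g n.+1 - n%:R - 2^-1)%:P by [].
have phi' : phi^`() = 2 * 'X.
  by rewrite /hermite_phi derivB derivC subr0 derivXn mulr_natl.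
have aE : a = n%:R - 2 * g n by [].
(* The constants [c] and [a] become opaque atoms for [ring]; [cE] and [aE] restore their values when
   coefficients are compared. *)
have [c cE] : exists c, c = g n + g n.+1 - n%:R - 2^-1 by eexists.
rewrite -cE in CE; clearbody a.
apply/eqP; rewrite -subr_eq0; apply/eqP; set r := _ - _.
have rE : r = phi * (P n)^`() - a *: ('X * P n)
            - (2 * g n) *: (phi * P m) - (2 * g n * c) *: P m.
  rewrite /r {2}/n hermite_recurrence -/n -!mul_polyC CE !rmorphM /=.
  rewrite rmorph_nat; ring.
(* The coefficient of x^(n+1) in [r] is n - a - 2 gamma_n, which is zero by the choice of [a]. *)
have sr : (size r <= n.+1)%N.
  apply/leq_sizeP => -[//|[//|j]] nj.
  rewrite rE !coefB !coefZ !coef_phiM coefXM.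
  rewrite !coef_deriv !coef_P /n /=; try lia.
  rewrite aE /n !eqSS.
  rewrite (_ : j.+2 == m = false) ?(_ : j.+3 == m.+1 = false); try lia.
  by case: eqVneq => [->|_]; rewrite /= !mul0rn !(mulr0, subr0)//; ring.
have rN : r \Po (- 'X) = (-1) ^+ m *: r.
  have phiN : phi \Po (- 'X) = phi.
    by rewrite /hermite_phi comp_polyB comp_polyC rmorphXn /= comp_polyX sqrrN.
  have dPN : (P n)^`() \Po (- 'X) = (-1) ^+ m *: (P n)^`().
    have := congr1 (fun p => - p^`()) (hermite_parity n).
    rewrite deriv_comp derivN derivX mulrN1 opprK derivZ => ->.
    by rewrite /n exprS mulN1r scaleNr opprK.
  rewrite rE !comp_polyB !comp_polyZ !comp_polyM phiN dPN comp_polyX.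
  rewrite !hermite_parity.
  rewrite /n exprS -!mul_polyC rmorphM rmorphN1 /=; ring.
apply: (hermite_expansion_eq0 sr) => k.
(* For k = n, [r] and [P n] have opposite parities, so the product is odd. *)
rewrite ltnS leq_eqVlt => /predU1P[->|kn].
  apply: hermite_functional_odd.
  rewrite comp_polyM rN hermite_parity -scalerAl -scalerAr scalerA.
  by rewrite /n exprS mulrCA -expr2 sqrr_sign mulr1 scaleN1r.
set q := P k.
have sq : (size q <= n)%N by rewrite size_P.
have coef_q j : (m < j)%N -> q`_j = 0.
  by move=> mj; rewrite nth_default// (leq_trans sq).
have dq : (size q^`() <= m)%N.
  by apply/leq_sizeP => j mj; rewrite coef_deriv coef_q ?mul0rn.
(* The case m = 0 is separate because [coef_phiM] covers only indices at least 2; there [q] is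
   constant. *)
have cdq : (phi * q^`())`_n = m%:R * q`_m.
  rewrite /n; case: (m) coef_q dq => [|m'] coef_q dq.
    by move: dq; rewrite size_poly_leq0 => /eqP->; rewrite mulr0 coef0 mul0r.
  by rewrite coef_phiM !coef_deriv (coef_q m'.+3)// mul0rn mulr0 subr0
    mulr_natl.
(* The first two terms cancel under [L]. The remaining ones pair with [P n] and [P n.+1] at the
   largest admissible degrees, so each contributes a multiple of the coefficient of x^m in [q]. *)
have -> : r * q = (phi * (P n * q))^`() - 2 * 'X * (phi * (P n * q))
    - ((2 + a + 2 * c) *: ('X * q) + phi * q^`()) * P n
    + (2 *: (phi * q + c *: q)) * P n.+1.
  rewrite /r CE derivM [(P n * q)^`()]derivM phi' -!mul_polyC.
  rewrite !rmorphD !rmorphM /= !rmorph_nat; ring.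
rewrite [LHS]raddfD /= raddfB /= raddfB /=.
rewrite hermite_functional_phi_deriv subrr sub0r.
rewrite !hermite_functional_coef; last 2 first.
- rewrite (leq_trans (size_scale_leq _ _))//.
  rewrite (leq_trans (size_polyD _ _))// geq_max size_phiM//=.
  by rewrite (leq_trans (size_scale_leq _ _))// ltnW// ltnW.
- rewrite (leq_trans (size_polyD _ _))// geq_max (size_phiM dq) andbT.
  rewrite (leq_trans (size_scale_leq _ _))// (leq_trans (size_polyMleq _ _))//.
  by rewrite size_polyX.
rewrite coefZ !coefD !coefZ coefXM cdq coef_phiM !(coef_q _.+2)//=.
rewrite -hermite_gammaS.
(* The balance is 2 + a + 2c + m = 2 gamma_(n+1); this fixes the constant -n - 1/2 in
   [hermite_C]. *)
by rewrite aE cE (_ : n%:R = m%:R + 1) ?natr1//; field.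
Qed.

(** * Elimination and the second-order equation *)

Lemma hermite_D_eq0 n : hermite_D z P n.+1 (P n.+1) = 0.
Proof.
set p := P n.+1; set q := P n; set a : R := n.+1%:R - 2 * g n.+1.
set C := hermite_C z P n.+1; set C' := hermite_C z P n.
have phi' : phi^`() = 2 * 'X.
  by rewrite /hermite_phi derivB derivC subr0 derivXn mulr_natl.
have lowering : phi * p^`() = a%:P * 'X * p + 2 * (g n.+1)%:P * C * q.
  rewrite hermite_structure hermite_recurrence -!mul_polyC.
  rewrite -/C -/p -/q -/a; ring.
have raising : phi * q^`() = (2 * phi - a%:P) * 'X * q - 2 * C' * p.
  rewrite hermite_structure -/C' -/p -/q -!mul_polyC.
  (* The constant part c' of [C'] is symmetric in gamma_n and gamma_(n+1), so n - 2 gamma_n = -a -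
     2c'. *)
  have -> : (n%:R - 2 * g n)%:P = 2 * phi - a%:P - 2 * C'.
    rewrite /C' /hermite_C; set c' := (_ - 2^-1).
    have -> : n%:R - 2 * g n = - a - 2 * c' by rewrite /a /c' -natr1; field.
    by rewrite rmorphB rmorphN rmorphM rmorph_nat /=; ring.
  ring.
(* Differentiating the lowering relation brings in the second derivative of [p]. *)
have lowering' : 2 * 'X * p^`() + phi * p^`()^`()
    = a%:P * (p + 'X * p^`()) + 2 * (g n.+1)%:P * (2 * 'X * q + C * q^`()).
  have C'X : C^`() = 2 * 'X by rewrite /C /hermite_C derivD derivC addr0.
  have d2 : (2 : {poly R})^`() = 0 by rewrite -(rmorph_nat polyC) derivC.
  move: (congr1 deriv lowering); rewrite derivM phi' => ->.
  rewrite derivD (derivM _ p) (derivM _ q) (derivM _ C) C'X.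
  rewrite !derivM !derivC derivX d2.
  ring.
rewrite /hermite_D -/p -/C -/C' /=.
set D := (X in X = _).
(* The factor [phi * C] matches the leading term of [D]; the multiplier of the raising relation then
   removes the derivative of [q], and that of the lowering relation removes [q] itself. *)
have -> : D = phi * C * (2 * 'X * p^`() + phi * p^`()^`()
    - (a%:P * (p + 'X * p^`()) + 2 * (g n.+1)%:P * (2 * 'X * q + C * q^`())))
  - 'X * (2 * phi + C * (2 * phi - a%:P)) *
    (phi * p^`() - (a%:P * 'X * p + 2 * (g n.+1)%:P * C * q))
  + 2 * (g n.+1)%:P * C ^+ 2
    * (phi * q^`() - ((2 * phi - a%:P) * 'X * q - 2 * C' * p)).
  have nE : n.+1%:R = a%:P + 2 * (g n.+1)%:P.
    by rewrite /a rmorphB rmorphM !rmorph_nat subrK.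
  rewrite /D -/a nE; ring.
by rewrite lowering lowering' raising !subrr !mulr0 subrr addr0.
Qed.


End TruncatedHermitePolynomials.

Theorem theorem19 (R : realType) (z : R) (z_gt0 : 0 < z)
    (P : nat -> {poly R}) (hP : truncated_hermite z P)
    (n : nat) (n_ge1 : (1 <= n)%N) :
  hermite_D z P n (P n) = 0.
Proof. by case: n n_ge1 => // n _; exact: hermite_D_eq0. Qed.
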